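(* Let $h\colon\mathbb{N}_2\to\mathbb{C}$ be a convex light weight. Suppose that $\sum_{n\ge1}|b_n^h|<1$. Then $B_h(1)_2$ exists, $B_h(1)_2\ne0$ and $$\lim_{n\to\infty}a_n^h=1-\frac{1}{B_h(1)_2}.$$
   Context: $\mathbb{N}=\{1,2,\dots\}$, $\mathbb{N}_0=\{0,1,2,\dots\}$, and $\mathbb{N}_2=\{e\subset\mathbb{N}:|e|=2\}$. A weight is a map $h\colon\mathbb{N}_2\to\mathbb{C}$. A walk of length $n\in\mathbb{N}_0$ is a tuple $w=\langle v_0,\dots,v_n\rangle$ of elements of $\mathbb{N}$ with $v_{i-1}\ne v_i$ for $i=1,\dots,n$; its weight is $h(w)=\prod_{i=1}^n h(\{v_{i-1},v_i\})$ (and $h(w)=1$ if $n=0$). A series $\sum_{x\in X}g(x)$ over an at most countable set $X$ converges absolutely if the sums $\sum_{x\in Y}|g(x)|$ over finite $Y\subset X$ are bounded; then its sum is independent of the order of summation. For a set $W$ of walks, $h(W)$ denotes the sum of $\sum_{w\in W}h(w)$ when it converges absolutely. $W(n)$ is the set of walks of length $n$ with $v_0=1$. The weight $h$ is light if $\sum_{w\in W(n)}h(w)$ converges absolutely for every $n\in\mathbb{N}_0$. $V(h)$ is the set of vertices $u\in\mathbb{N}$ such that some walk starting at $1$ and ending at $u$ has nonzero weight. A light weight $h$ is convex if for every $u\in V(h)$, $\sum_{v\in\mathbb{N}\setminus\{u\}}h(\{u,v\})=1$. Define $a_n^h=h(W(1,n))$, where $W(1,n)$ is the set of walks in $W(n)$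 with $v_i=1$ for some $i\in\{1,\dots,n\}$; $B_h(x)=\sum_{n\ge0}b_n^hx^n$ with $b_n^h=h(W_b(n))$, where $W_b(n)$ is the set of walks of length $n$ with $v_0=v_n=1$. For $U(x)=\sum_{n\ge0}u_nx^n\in\mathbb{C}[[x]]$, we say $U(1)_2$ exists if $\sum_{n\ge0}|u_n|<\infty$, and then $U(1)_2=\sum_{n\ge0}u_n$. *)

(* Defs.v *)
From HB Require Import structures.
From mathcomp Require Import all_boot all_order all_algebra finmap.
From mathcomp Require Import all_classical all_reals all_analysis.
From mathcomp.analysis.showcase Require summability.
From mathcomp.real_closed Require Import complex.

Set Implicit Arguments.
Unset Strict Implicit.
Unset Printing Implicit Defensive.

Import Order.TTheory GRing.Theory Num.Theory.
Import numFieldNormedType.Exports.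

Local Open Scope classical_set_scope.
Local Open Scope ring_scope.
Local Open Scope complex_scope.

(* The usual topology of the complex plane, i.e. the one induced by the modulus. *)
#[warnings="-redundant-canonical-projection"]
HB.instance Definition _ (R : realType) := NormedModule.copy R[i] R[i]^o.

Notation modulus := ComplexField.Normc.normc.

Section UnorderedSums.
Context {R : realType} {T : choiceType}.
Implicit Types (X : set T) (g : T -> R[i]).

(* The \esum of a nonnegative family is the supremum of its finite partial
   sums, so this says that the finite sums of |g| over X are bounded. *)
Definition abs_convergent X g : Prop :=
  (\esum_(x in X) (modulus (g x))%:E < +oo)%E.

(* Limit of the partial sums along the directed set of finite subsets.
   Only meaningful when abs_convergent X g holds. *)
Definition set_sum X g : R[i] := summability.sum (patch (fun=> 0) X g).

End UnorderedSums.

Section PowerSeriesAtOne.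
Context {R : realType}.
(* A formal power series is given by its sequence of coefficients. *)
Implicit Type u : nat -> R[i].

Definition exists_at1 u : Prop :=
  (\sum_(0 <= n <oo) (modulus (u n))%:E < +oo)%E.

Definition value_at1 u : R[i] := limn (series u).

End PowerSeriesAtOne.

Notation vertex := {n : nat | (0 < n)%N}.

Definition v1 : vertex := exist _ 1%N isT.

Notation edge := {e : {fset vertex} | #|` e |%fset == 2%N}.

Section Walks.
Context {R : realType}.
Implicit Type h : edge -> R[i].

(* h({u, v}).  For u = v the set {u, v} is not an edge and the value is the
   dummy 0, which is never used below: consecutive vertices are distinct. *)
Definition edge_weight h (u v : vertex) : R[i] :=
  oapp h 0 (insub [fset u; v]%fset).

(* A walk <v_0, ..., v_n> is the sequence of its n + 1 vertices. *)
Definition is_walk (n : nat) (w : seq vertex) : Prop :=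
  size w = n.+1 /\ forall i, (i < n)%N -> nth v1 w i != nth v1 w i.+1.

Definition walk_weight h (w : seq vertex) : R[i] :=
  \prod_(i < (size w).-1) edge_weight h (nth v1 w i) (nth v1 w i.+1).

Definition W (n : nat) : set (seq vertex) :=
  [set w | is_walk n w /\ nth v1 w 0 = v1].

Definition W1 (n : nat) : set (seq vertex) :=
  [set w | W n w /\ exists i, (1 <= i <= n)%N /\ nth v1 w i = v1].

Definition Wb (n : nat) : set (seq vertex) :=
  [set w | W n w /\ nth v1 w n = v1].

Definition light h : Prop := forall n, abs_convergent (W n) (walk_weight h).

Definition V h : set vertex :=
  [set u | exists n w, [/\ W n w, nth v1 w n = u & walk_weight h w != 0]].

Definition convex h : Prop :=
  forall u, V h u ->
    abs_convergent [set v | v != u] (edge_weight h u) /\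
    set_sum [set v | v != u] (edge_weight h u) = 1.

Definition a_coef h (n : nat) : R[i] := set_sum (W1 n) (walk_weight h).

Definition b_coef h (n : nat) : R[i] := set_sum (Wb n) (walk_weight h).

End Walks.

(* Main.v *)
(* By convexity the walks of length n from v1 have total weight 1. Cutting each
   of them at its last visit to v1 turns this into the renewal equation
   sum_(k <= n) b_k c_(n-k) = 1, where c_m = 1 - a_m is the weight of the walks
   of length m which never return to v1. As b_0 = 1 and
   r = sum_(k >= 1) |b_k| < 1,
   we get |B(1)| >= 1 - r > 0 and c is bounded. The differences
   d_n = c_n - 1/B(1) satisfy |d_n| <= e_n + sum_(1 <= k <= n) |b_k| |d_(n-k)|
   with e_n -> 0; an eventual bound M on |d_n| thus improves to about r M, and
   so d_n -> 0. *)
Require Import Defs.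
From mathcomp Require Import all_boot all_order all_algebra finmap.
From mathcomp Require Import all_classical all_reals all_analysis.
From mathcomp.analysis.showcase Require summability.
From mathcomp.real_closed Require Import complex.
From mathcomp Require Import ring lra zify.

Set Implicit Arguments.
Unset Strict Implicit.
Unset Printing Implicit Defensive.

Import Order.TTheory GRing.Theory Num.Theory.
Import numFieldNormedType.Exports.

Local Open Scope classical_set_scope.
Local Open Scope ring_scope.
Local Open Scope complex_scope.

(** * Unordered sums of complex families *)

#[local] Existing Instance summability.totally_filter.

Section HasSum.
Context {R : realType}.

Lemma normr_modulus (z : R[i]) : `|z| = (modulus z)%:C.
Proof. by rewrite normc_def; case: z. Qed.

Lemma modulus_ge0 (z : R[i]) : 0 <= modulus z.
Proof. by rewrite -ler0c -normr_modulus. Qed.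

Lemma modulus_real (x : R) : modulus x%:C = `|x|.
Proof. by rewrite /= expr0n addr0 sqrtr_sqr. Qed.

Lemma gt0_complex (e : R[i]) : 0 < e -> exists2 d : R, 0 < d & e = d%:C.
Proof.
by case: e => a b; rewrite ltcE /= => /andP[/eqP -> a0]; exists a.
Qed.

(* Unlike set_sum, which is a limit that may fail to exist, has_sum is a genuine
   convergence statement. *)
Definition has_sum {T : choiceType} (X : set T) (g : T -> R[i]) (s : R[i]) :=
  summability.partial_sum (patch (fun=> 0) X g) @ summability.totally --> s.

Lemma cvg_modulusP {T : Type} (F : set_system T) {FF : Filter F} (f : T -> R[i])
    (l : R[i]) :
  (f @ F --> l) <-> (forall e : R, 0 < e -> \forall x \near F, modulus (l - f x) < e).
Proof.
split=> [/cvgrPdist_lt fl e e0|fl].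
  have := fl e%:C; rewrite ltcR => /(_ e0); apply: filterS => x.
  by rewrite normr_modulus ltcR.
apply/cvgrPdist_lt => e /gt0_complex[d d0 ->].
by apply: filterS (fl _ d0) => x; rewrite normr_modulus ltcR.
Qed.

(** * Sums over a single index type *)

Section OneType.
Context {T : choiceType}.
Implicit Types (X : set T) (g : T -> R[i]).

Lemma partial_sumE (g : T -> R[i]) (A : {fset T}) :
  summability.partial_sum g A = \sum_(i <- A) g i.
Proof. by rewrite /summability.partial_sum big_seq_fsetE. Qed.

Lemma has_sum_set_sum X g s : has_sum X g s -> set_sum X g = s.
Proof. by move=> gs; apply: cvg_lim => //; exact: norm_hausdorff. Qed.

Lemma has_sum_unique X g s t : has_sum X g s -> has_sum X g t -> s = t.
Proof. by move=> /has_sum_set_sum <- /has_sum_set_sum <-. Qed.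

Lemma eq_has_sum X g g' s :
  (forall x, X x -> g x = g' x) -> has_sum X g s -> has_sum X g' s.
Proof.
move=> gg'; rewrite /has_sum; suff -> : patch (fun=> 0) X g = patch (fun=> 0) X g' by [].
by apply/funext => x; rewrite /patch; case: ifPn => // /set_mem /gg'.
Qed.

Lemma has_sum_lin X g g' s s' (c : R[i]) : has_sum X g s -> has_sum X g' s' ->
  has_sum X (fun x => g x + c * g' x) (s + c * s').
Proof.
move=> gs gs'; rewrite /has_sum.
have -> : summability.partial_sum (patch (fun=> 0) X (fun x => g x + c * g' x)) =
  summability.partial_sum (patch (fun=> 0) X g) \+
    (fun A => c *: summability.partial_sum (patch (fun=> 0) X g') A).
  apply/funext => A /=; rewrite !partial_sumE scaler_sumr -big_split /=.
  apply: eq_bigr => i _; rewrite /patch; case: ifPn => //.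
  by rewrite scaler0 addr0.
by apply: (cvgD gs); apply: cvgZr.
Qed.

Lemma has_sum0 X : has_sum X (fun=> 0) 0.
Proof.
apply: cvg_near_cst; apply: nearW => A /=; rewrite partial_sumE big1// => i _.
by rewrite /patch; case: ifP.
Qed.

Lemma has_sumZ X g s (c : R[i]) : has_sum X g s ->
  has_sum X (fun x => c * g x) (c * s).
Proof.
move=> gs; rewrite -[c * s]add0r.
apply: eq_has_sum (has_sum_lin (c := c) (has_sum0 X) gs) => x _.
by rewrite add0r.
Qed.

Lemma has_sum_fin X g : finite_set X -> has_sum X g (\sum_(x \in X) g x).
Proof.
move=> finX; rewrite /has_sum.
apply: cvg_near_cst; exists (fset_set X) => //= B XB.
rewrite partial_sumE fsbig_seq//.
rewrite -fsbig_mkcondr setIidr// => x Xx /=.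
by apply: (fsubsetP XB); rewrite in_fset_set// inE.
Qed.

Lemma has_sum_set1 x g : has_sum [set x] g (g x).
Proof. by rewrite -(fsbig_set1 +%R x g); exact: has_sum_fin. Qed.

(** Some finite [A] has partial sum within [e] of the supremum; as the terms are nonnegative, every
    larger finite set has its partial sum between that of [A] and the supremum. *)
Lemma has_sum_nneg X (p : T -> R) : (forall x, 0 <= p x) ->
  (\esum_(x in X) (p x)%:E < +oo)%E ->
  has_sum X (fun x => (p x)%:C) (fine (\esum_(x in X) (p x)%:E))%:C.
Proof.
move=> p0 fin; set S := esum _ _ in fin *.
have Sfin : S \is a fin_num by rewrite ge0_fin_numE// esum_ge0// => x _; rewrite lee_fin.
have psE B : summability.partial_sum (patch (fun=> 0) X (fun x => (p x)%:C)) B =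
    (\sum_(x <- B) patch (fun=> 0) X p x)%:C.
  rewrite partial_sumE rmorph_sum; apply: eq_bigr => x _.
  by rewrite /patch; case: ifP => _; rewrite ?rmorph0.
apply/cvg_modulusP => e e0.
have [_ [A [finA AX] <-]] := @ub_ereal_sup_adherent R _ e e0 Sfin.
rewrite -/(esum _ _) -/S => ltA; exists (fset_set A) => // B /= AB.
set t := \sum_(x <- B) patch (fun=> 0) X p x.
have tE : t%:E = (\sum_(x \in [set` B] `&` X) (p x)%:E)%E.
  rewrite fsbig_mkcondr -fsbig_seq//.
  by rewrite -sumEFin; apply: eq_bigr => x _; rewrite /patch; case: ifP.
have tS : (t%:E <= S)%E.
  rewrite tE; apply: ereal_sup_ubound; exists ([set` B] `&` X) => //; split.
    by apply: finite_setIl; exact: finite_fset.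
  by move=> x [].
have St : (S - e%:E < t%:E)%E.
  apply: (lt_le_trans ltA); rewrite tE; apply: lee_fsum_nneg_subset => //.
  - by apply: finite_setIl; exact: finite_fset.
  - move=> x; rewrite !inE => Ax; split; last exact: AX.
    by apply: (fsubsetP AB); rewrite in_fset_set// inE.
  - by move=> x _; rewrite lee_fin.
rewrite psE -rmorphB modulus_real.
move: tS St; rewrite -(fineK Sfin) lee_fin -EFinB lte_fin => tS St.
by rewrite ger0_norm ?subr_ge0//= -/t; lra.
Qed.
(* Split a complex family into the positive and negative parts of its real and
   imaginary parts: statements about absolutely convergent families which are
   stable under linear combinations reduce to facts about esum. *)
Lemma abs_convergent_ind X (P : (T -> R[i]) -> Prop) :
    (forall p : T -> R, (forall x, 0 <= p x) ->
      (\esum_(x in X) (p x)%:E < +oo)%E -> P (fun x => (p x)%:C)) ->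
    (forall c g g', P g -> P g' -> P (fun x => g x + c * g' x)) ->
  forall g, abs_convergent X g -> P g.
Proof.
move=> Ppos Plin g fing.
pose pos (f : T -> R) x := Num.max (f x) 0.
have Ppart (f : T -> R) : (forall x, `|f x| <= modulus (g x)) -> P (fun x => (f x)%:C).
  have Ppos' (f' : T -> R) : (forall x, `|f' x| <= modulus (g x)) ->
      P (fun x => (pos f' x)%:C).
    move=> f'g; apply: Ppos => [x|]; first by rewrite le_max lexx orbT.
    apply: le_lt_trans fing; apply: le_esum => x _; rewrite lee_fin.
    by rewrite ge_max modulus_ge0 (le_trans (ler_norm _) (f'g _)).
  move=> fg; have := Plin (-1) _ _ (Ppos' f fg) (Ppos' (\- f) _).
  have -> : (fun x => (pos f x)%:C + -1 * (pos (\- f) x)%:C) = (fun x => (f x)%:C).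
    apply/funext => x; rewrite mulN1r -rmorphB; congr _%:C.
    by rewrite /pos /=; case: (ltP (f x) 0); case: (ltP (- f x) 0); lra.
  by apply => x /=; rewrite normrN.
have -> : g = (fun x => (complex.Re (g x))%:C + 'i%C * (complex.Im (g x))%:C).
  by apply/funext => x; exact: complexE.
apply: Plin; apply: Ppart => x; case: (g x) => a b /=;
  by rewrite -sqrtr_sqr ler_sqrt ?addr_ge0 ?sqr_ge0// ?lerDl ?lerDr sqr_ge0.
Qed.

Lemma abs_convergent_sub X X' g : X `<=` X' ->
  abs_convergent X' g -> abs_convergent X g.
Proof.
move=> XX'; apply: le_lt_trans; rewrite esum_mkcond [leRHS]esum_mkcond.
apply: le_esum => x _; case: ifPn => [/set_mem/XX' X'x|_].
  by rewrite ifT ?inE.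
by case: ifP => //; rewrite lee_fin modulus_ge0.
Qed.

Lemma abs_convergent_has_sum X g : abs_convergent X g -> has_sum X g (set_sum X g).
Proof.
move=> fing; suff [s gs] : exists s, has_sum X g s by rewrite (has_sum_set_sum gs).
elim/abs_convergent_ind : g / fing => [p p0 pfin|c f f' [s fs] [s' fs']].
  by eexists; exact: has_sum_nneg.
by eexists; exact: has_sum_lin fs fs'.
Qed.

End OneType.

(** * Reindexing and grouping of sums *)

Lemma has_sum_image (T T' : choiceType) (f : T -> T') (X : set T) g s :
    set_inj X f -> abs_convergent (f @` X) g ->
  has_sum X (g \o f) s -> has_sum (f @` X) g s.
Proof.
move=> finj fing gfs.
(* With the sum quantified existentially the claim is stable under linear combinations, so
   [abs_convergent_ind] applies; uniqueness of limits then recovers [s]. *)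
suff [t [gt gft]] : exists t, has_sum (f @` X) g t /\ has_sum X (g \o f) t.
  by rewrite (has_sum_unique gfs gft).
move: g fing {gfs}; apply: abs_convergent_ind
  => [p p0 pfin|c h h' [t [ht hft]] [t' [ht' hft']]].
  eexists; split; first exact: has_sum_nneg.
  rewrite esum_image//; apply: (@has_sum_nneg _ _ (p \o f)) => [x|] /=.
    exact: p0.
  by rewrite -(esum_image _ _ (fun x => (p x)%:E)).
exists (t + c * t'); split; first exact: has_sum_lin.
exact: has_sum_lin hft hft'.
Qed.

(** A Fubini theorem for grouped sums. For nonnegative families it is the exchange of a double
    [esum] with a sum over pairs; absolute convergence carries it over to complex families. *)
Lemma has_sum_bigcup (I T : choiceType) (Y : set I) (J : I -> set T) S g s :
    trivIset Y J -> abs_convergent (\bigcup_(i in Y) J i) g ->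
    (forall i, Y i -> has_sum (J i) g (S i)) ->
  has_sum Y S s -> has_sum (\bigcup_(i in Y) J i) g s.
Proof.
move=> tJ; set U := \bigcup_(i in Y) J i => fing gS Ss.
suff [S' [t [gS' S't gt]]] : exists S' t,
    [/\ forall i, Y i -> has_sum (J i) g (S' i), has_sum Y S' t & has_sum U g t].
  suff -> : s = t by [].
  apply: has_sum_unique Ss _; apply: eq_has_sum S't => i Yi.
  exact: has_sum_unique (gS' _ Yi) (gS _ Yi).
move: g fing {gS Ss}; apply: abs_convergent_ind
  => [p p0 pfin|c h h' [S' [t [hS' S't ht]]] [S'' [t' [hS'' S''t' ht']]]]; last first.
  exists (fun i => S' i + c * S'' i), (t + c * t'); split.
  - by move=> i Yi; apply: has_sum_lin; [exact: hS'|exact: hS''].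
  - exact: has_sum_lin.
  - exact: has_sum_lin.
(* The union is reindexed by the pairs [(i, x)] with [x] in [J i]; disjointness of the blocks makes
   the second projection injective. *)
have UE : \esum_(x in U) (p x)%:E = \esum_(i in Y) \esum_(x in J i) (p x)%:E.
  rewrite esum_esum; last by move=> i j _ _; rewrite lee_fin.
  apply: reindex_esum; split.
  - by move=> [i x] /= [Yi Jx]; exists i.
  - move=> [i x] [i' x'] /=; rewrite !inE /= => -[Yi Jx] [Yi' Jx'] xx'.
    by rewrite -xx' in Jx' *; congr (_, _); apply: tJ => //; exists x.
  - by move=> x [i Yi Jx]; exists (i, x).
have JU i : Y i -> (\esum_(x in J i) (p x)%:E < +oo)%E.
  move=> Yi; have : abs_convergent U (fun x => (p x)%:C).
    by apply: le_lt_trans pfin; apply: le_esum => x _; rewrite modulus_real ger0_norm.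
  move=> /(@abs_convergent_sub _ (J i)) H.
  apply: le_lt_trans (H _); last by move=> x Jx; exists i.
  by apply: le_esum => x _; rewrite modulus_real ger0_norm.
have J0 i : (0 <= \esum_(x in J i) (p x)%:E)%E.
  by apply: esum_ge0 => x _; rewrite lee_fin.
have UE' : \esum_(x in U) (p x)%:E =
    \esum_(i in Y) (fine (\esum_(x in J i) (p x)%:E))%:E.
  by rewrite UE; apply: eq_esum => i Yi; rewrite fineK// ge0_fin_numE// JU.
eexists; eexists; split; last exact: has_sum_nneg.
  by move=> i Yi; apply: has_sum_nneg => //; exact: JU.
rewrite UE'; apply: has_sum_nneg => [i|]; last by rewrite -UE'.
exact: fine_ge0.
Qed.

End HasSum.

(** * Walks *)

Section Tails.
Context {R : realType}.
Variable h : edge -> R[i].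

(* A walk from v1 is encoded by its vertices after v_0; walk_weight then becomes
   the structurally recursive tail_weight. *)
Definition tails n : set (seq vertex) :=
  [set t | size t = n /\ path (fun u v => u != v) v1 t].

Fixpoint tail_weight (u : vertex) (t : seq vertex) : R[i] :=
  if t is v :: t' then edge_weight h u v * tail_weight v t' else 1.

Lemma tail_weight_cat u t1 t2 :
  tail_weight u (t1 ++ t2) = tail_weight u t1 * tail_weight (last u t1) t2.
Proof. by elim: t1 u => [|v t1 IH] u /=; rewrite ?mul1r// IH mulrA. Qed.

Lemma walk_weight_cons u t : walk_weight h (u :: t) = tail_weight u t.
Proof.
rewrite /walk_weight /=; elim: t u => [|v t IH] u; first by rewrite big_ord0.
by rewrite /= big_ord_recl /= -IH.
Qed.

Lemma W_tails n : W n = cons v1 @` tails n.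
Proof.
apply/seteqP; split=> [[|u t]|_ [t [tn pt] <-]].
- by case=> [[]].
- case=> [[/= [tn] wt] /= uv]; exists t; last by rewrite uv.
  split => //; apply/(pathP v1) => i; rewrite tn => /wt.
  by rewrite uv.
- split => //; split=> [|i]; first by rewrite /= tn.
  by rewrite -tn => it; exact: (pathP v1 pt i it).
Qed.

Lemma W1_tails n : W1 n = cons v1 @` (tails n `&` [set t : seq vertex | v1 \in t]).
Proof.
apply/seteqP; split=> [w [+ [i [/andP[i0 iN]]]]|_ [t [tn /= vt] <-]].
  rewrite W_tails => -[t tn <-]; case: i i0 iN => // i _ iN /= ti.
  exists t => //; split => //=; rewrite -ti mem_nth//.
  by case: tn => ->.
split; first by rewrite W_tails; exists t.
exists (index v1 t).+1; rewrite /= nth_index//; split => //.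
by case: tn => <- _; rewrite index_mem.
Qed.

Lemma Wb_tails n : Wb n = cons v1 @` (tails n `&` [set t : seq vertex | last v1 t = v1]).
Proof.
have nth_last t : tails n t -> nth v1 (v1 :: t) n = last v1 t.
  by case=> <- _; rewrite -[RHS]/(last v1 (v1 :: t)) -nth_last.
apply/seteqP; split=> [w []|_ [t [tn /= vt] <-]].
  rewrite W_tails => -[t tn <-]; rewrite nth_last// => tv.
  by exists t.
by split; rewrite ?W_tails ?nth_last//; exists t.
Qed.

(** * Sums over the walks of a light weight *)

Hypothesis h_light : light h.

Lemma abs_convergent_tails n : abs_convergent (tails n) (tail_weight v1).
Proof.
have := h_light n; rewrite /abs_convergent W_tails esum_image//; last by move=> t t' _ _ [].
by under eq_esum do rewrite walk_weight_cons.
Qed.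

Lemma set_sum_tails n (X : set (seq vertex)) : X `<=` tails n ->
  set_sum (cons v1 @` X) (walk_weight h) = set_sum X (tail_weight v1).
Proof.
move=> Xn; apply: has_sum_set_sum; apply: has_sum_image.
- by move=> t t' _ _ [].
- by apply: abs_convergent_sub (h_light n); rewrite W_tails; exact: image_subset.
apply: (@eq_has_sum _ _ _ (tail_weight v1)) => [t _|]; first by rewrite /= walk_weight_cons.
apply: abs_convergent_has_sum; apply: abs_convergent_sub (@abs_convergent_tails n).
exact: Xn.
Qed.

(** These encode [Wb n] and the complement of [W1 n] in [W n]. For [n = 0] the empty tail belongs to
    both, so that a walk ending at [v1] can be cut at its end. *)
Definition returning n := tails n `&` [set t : seq vertex | last v1 t = v1].
Definition avoiding n := tails n `&` [set t : seq vertex | v1 \notin t].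
Definition c_coef n : R[i] := set_sum (avoiding n) (tail_weight v1).

Lemma has_sum_b n : has_sum (returning n) (tail_weight v1) (b_coef h n).
Proof.
rewrite /b_coef Wb_tails (set_sum_tails (n := n)); last by move=> t [].
apply: abs_convergent_has_sum; apply: abs_convergent_sub (@abs_convergent_tails n).
by move=> t [].
Qed.

Lemma has_sum_c n : has_sum (avoiding n) (tail_weight v1) (c_coef n).
Proof.
apply: abs_convergent_has_sum; apply: abs_convergent_sub (@abs_convergent_tails n).
by move=> t [].
Qed.

Lemma has_sum_a n :
  has_sum (tails n `&` [set t : seq vertex | v1 \in t]) (tail_weight v1) (a_coef h n).
Proof.
rewrite /a_coef W1_tails (set_sum_tails (n := n)); last by move=> t [].
apply: abs_convergent_has_sum; apply: abs_convergent_sub (@abs_convergent_tails n).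
by move=> t [].
Qed.

Lemma b_coef0 : b_coef h 0 = 1.
Proof.
apply: (has_sum_unique (@has_sum_b 0)).
have -> : returning 0 = [set [::]].
  by apply/seteqP; split => [[|v t]|_ ->] // [[]].
exact: (@has_sum_set1 _ _ [::] (tail_weight v1)).
Qed.

(** * Consequences of convexity and the cut at the last visit *)

Hypothesis h_convex : convex h.

(** Induction on the length: the one-step extensions of a walk together weigh as much as the walk
    itself, since the edges at its end vertex have total weight 1. *)
Lemma has_sum_tails n : has_sum (tails n) (tail_weight v1) 1.
Proof.
elim: n => [|n IH].
  have -> : tails 0 = [set [::]].
    by apply/seteqP; split => [[|v t]|_ ->] // [].
  exact: (@has_sum_set1 _ _ [::] (tail_weight v1)).
have tailsS : tails n.+1 =
    \bigcup_(t in tails n) (rcons t @` [set v | v != last v1 t]).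
  apply/seteqP; split => [t|_ [t [tn pt]] [v /= vt] <-].
    case/lastP: t => [[]//|t v [] /[!size_rcons] -[tn]].
    rewrite rcons_path => /andP[pt tv]; exists t => //; exists v => //=.
    by rewrite eq_sym.
  by split; rewrite ?size_rcons ?tn// rcons_path pt eq_sym.
rewrite tailsS; apply: (has_sum_bigcup (S := tail_weight v1) _ _ _ IH).
- by move=> t t' _ _ [_ [[v _ <-] [v' _ /rcons_inj[]]]].
- by rewrite -tailsS; exact: abs_convergent_tails.
move=> t tn; apply: has_sum_image.
- by move=> v v' _ _ /rcons_inj[].
- apply: abs_convergent_sub (@abs_convergent_tails n.+1); rewrite tailsS.
  by move=> ? ?; exists t.
apply: (@eq_has_sum _ _ _ (fun v => tail_weight v1 t * edge_weight h (last v1 t) v)).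
  by move=> v _ /=; rewrite -cats1 tail_weight_cat /= mulr1.
(* Convexity only concerns the vertices in [V h]. A walk of nonzero weight ends there; a walk of
   zero weight has only extensions of zero weight. *)
have [->|t0] := eqVneq (tail_weight v1 t) 0.
  apply: (@eq_has_sum _ _ _ (fun=> 0)) => [v _|]; first by rewrite mul0r.
  exact: has_sum0.
rewrite -[X in has_sum _ _ X]mulr1; apply: has_sumZ.
have [|ac <-] := h_convex (u := last v1 t).
  exists n, (v1 :: t); split.
  - by rewrite W_tails; exists t.
  - by case: tn => <- _; rewrite -[RHS]/(last v1 (v1 :: t)) -nth_last.
  - by rewrite walk_weight_cons.
exact: abs_convergent_has_sum.
Qed.

Lemma a_c_coef n : a_coef h n = 1 - c_coef n.
Proof.
pose J (b : bool) := tails n `&` [set t : seq vertex | (v1 \in t) = b].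
have tE : tails n = \bigcup_(b in setT) J b.
  apply/seteqP; split => [t tn|t [b _ []]//]; by exists (v1 \in t).
apply/eqP; rewrite eq_sym subr_eq; apply/eqP.
apply: (has_sum_unique (@has_sum_tails n)); rewrite [in X in has_sum X]tE.
apply: (has_sum_bigcup (S := fun b : bool => if b then a_coef h n else c_coef n)).
- by move=> b b' _ _ [t [[_ /= <-] [_ /= <-]]].
- by rewrite -tE; exact: abs_convergent_tails.
- move=> [] _; first exact: has_sum_a.
  have -> : J false = avoiding n by apply/seteqP; split=> t [tn /=] => [/negbT|/negPf].
  exact: has_sum_c.
have -> : a_coef h n + c_coef n =
   \sum_(b \in [set: bool]) (if b then a_coef h n else c_coef n).
  rewrite (fsbigE [:: true; false])//= ?big_cons ?big_nil ?mem_setT ?addr0//.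
  by case.
apply: has_sum_fin; exact: finite_finset.
Qed.

(** Here [k] is the time of the last visit to [v1], with [k = 0] if the walk never returns. *)
Lemma tails_last_visit n : tails n =
  \bigcup_(k in `I_n.+1) \bigcup_(t in returning k) (cat t @` avoiding (n - k)).
Proof.
apply/seteqP; split => [t [tn pt]|_ [k kn [t1 [[t1k p1] /= l1] [t2 [[t2n p2] _] <-]]]]; last first.
  split; first by rewrite size_cat t1k t2n subnKC.
  by rewrite cat_path p1 l1.
(* Induction from the right: a new last vertex [v1] moves the cut to the end, any other vertex is
   appended to [t2]. *)
have [t1 [t2 [tE l1 v2]]] : exists t1 t2, [/\ t = t1 ++ t2, last v1 t1 = v1 & v1 \notin t2].
  elim/last_ind: t {tn pt} => [|t v [t1 [t2 [-> l1 v2]]]]; first by exists [::], [::].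
  have [->|vv] := eqVneq v v1.
    by exists (rcons (t1 ++ t2) v1), [::]; rewrite cats0 last_rcons.
  exists t1, (rcons t2 v); split => //; first by rewrite -rcons_cat.
  by rewrite mem_rcons in_cons negb_or eq_sym vv.
move: tn pt; rewrite tE size_cat cat_path l1 => tn /andP[p1 p2].
exists (size t1) => /=; first by rewrite ltnS -tn leq_addr.
exists t1 => //; exists t2 => //; split => //; split => //.
by rewrite -tn addKn.
Qed.

(** The part after the last visit starts at [v1] again, so the weight of a walk is the product of
    the weights of its two parts. *)
Lemma renewal n : \sum_(k < n.+1) b_coef h k * c_coef (n - k) = 1.
Proof.
apply: esym; apply: (has_sum_unique (@has_sum_tails n)); rewrite tails_last_visit.
have sub k : `I_n.+1 k -> \bigcup_(t in returning k) (cat t @` avoiding (n - k)) `<=` tails n.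
  by move=> kn t kt; rewrite tails_last_visit; exists k.
apply: (has_sum_bigcup (S := fun k => b_coef h k * c_coef (n - k))).
- apply/trivIsetP.
  (* If two such concatenations agree, t1' extends t1 and ends at v1, which
     forces t2 to visit v1. *)
  have disjoint_lt k k' : (k < k')%N -> 
   \bigcup_(t in returning k) (cat t @` avoiding (n - k)) `&`
   \bigcup_(t in returning k') (cat t @` avoiding (n - k')) = set0.
    move=> kk'; rewrite -subset0 => _ [[t1 [[t1k _] /= l1] [t2 [_ /= v2] <-]]].
    move=> [t1' [[t1k' _] /= l1'] [t2' _ tE]].
    have t1E : t1' = t1 ++ drop k t1'.
      rewrite -[LHS](cat_take_drop k); congr (_ ++ _).
      have := congr1 (take k) tE; rewrite takel_cat; last by rewrite t1k' ltnW.
      by move=> ->; rewrite -t1k take_size_cat.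
    have t2E : t2 = drop k t1' ++ t2'.
      have := congr1 (drop k) tE; rewrite drop_cat t1k' kk' => ->.
      by rewrite -t1k drop_size_cat.
    move/negP: v2; apply; rewrite t2E mem_cat; apply/orP; left.
    rewrite t1E last_cat l1 in l1'.
    have : size (drop k t1') != 0%N by rewrite size_drop t1k' subn_eq0 -ltnNge.
    by case: (drop k t1') l1' => //= v s lv _; have := mem_last v s; rewrite lv.
  move=> k k' _ _; rewrite neq_ltn => /orP[/disjoint_lt//|/disjoint_lt].
  by rewrite setIC.
- by rewrite -tails_last_visit; exact: abs_convergent_tails.
(* For fixed [k], sum over the avoiding part with the returning part [t] fixed, then over [t]. All
   [t] have length [k], so equal concatenations have equal prefixes. *)
- move=> k kn; apply: (has_sum_bigcup (S := fun t => c_coef (n - k) * tail_weight v1 t)).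
  + move=> t t' [[tk _] _] [[t'k _] _] [_ [[s _ <-] [s' _]]].
    by move/eqP; rewrite eqseq_cat ?tk ?t'k// => /andP[/eqP].
  + exact: abs_convergent_sub (sub _ kn) (@abs_convergent_tails n).
  + move=> t tk; rewrite mulrC; apply: has_sum_image.
    * by move=> s s' _ _ /eqP; rewrite eqseq_cat// eqxx => /eqP.
    * apply: abs_convergent_sub (@abs_convergent_tails n).
      by apply: subset_trans (sub _ kn); move=> s ts; exists t.
    * apply: (@eq_has_sum _ _ _ (fun s => tail_weight v1 t * tail_weight v1 s)).
        by case: tk => _ /= l1 s _; rewrite /= tail_weight_cat l1.
      by apply: has_sumZ; exact: has_sum_c.
  + by rewrite mulrC; apply: has_sumZ; exact: has_sum_b.
- rewrite (fsbig_ord _ _ (fun k => b_coef h k * c_coef (n - k))).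
  exact: has_sum_fin.
Qed.

End Tails.

(** * The renewal equation *)

Section Renewal.
Context {R : realType}.

(** A contraction argument on eventual bounds: starting from [K], the bound [M] is repeatedly
    replaced by [r * M + d] with [d] arbitrarily small. *)
Lemma renewal_inequality_cvg0 (beta x e : nat -> R) (r K : R) :
    (forall k, 0 <= beta k) -> r < 1 ->
    (forall n, \sum_(1 <= k < n) beta k <= r) ->
    (forall n, 0 <= x n <= K) -> e @ \oo --> 0 ->
    (forall n, x n <= e n + \sum_(1 <= k < n.+1) beta k * x (n - k)%N) ->
  x @ \oo --> 0.
Proof.
move=> beta0 r1 br xK e0 xe.
have r0 : 0 <= r by have := br 0; rewrite big_geq.
have K0 : 0 <= K by have /andP[] := xK 0; exact: le_trans.
have tail (d : R) : 0 < d -> exists m, (0 < m)%N /\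
    forall n, (m <= n)%N -> \sum_(m <= k < n) beta k <= d.
  move=> d0; pose s n := \sum_(1 <= k < n) beta k.
  have s_mono : nondecreasing_seq s.
    apply/nondecreasing_seqP => -[|n]; rewrite /s; first by rewrite !big_geq.
    by rewrite [leRHS]big_nat_recr//= lerDl.
  have s_cvg : cvgn s by apply: nondecreasing_is_cvgn => //; exists r => _ [n _ <-]; exact: br.
  have /cvgrPdist_lt/(_ _ d0) [N _ sN] := s_cvg.
  exists N.+1; split => // n Nn.
  have := nondecreasing_cvgn_le s_mono s_cvg n.
  have := sN N.+1 (leqnSn N); rewrite ger0_norm ?subr_ge0; last exact: nondecreasing_cvgn_le.
  have -> : s n = s N.+1 + \sum_(N.+1 <= k < n) beta k by rewrite /s -big_cat_nat.
  lra.
(* Split the sum at a fixed [m]. For [k < m] the index [n - k] is still large, so these terms add up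
   to at most [r * M]; for [k >= m] only [x <= K] is used, but there the [beta k] have a small
   sum. *)
have step (M d : R) : 0 < d -> 0 <= M -> (\forall n \near \oo, x n <= M) ->
    \forall n \near \oo, x n <= r * M + d.
  move=> d0 M0 [N _ xM].
  (* Dividing by [K + 1] instead of [K] covers the case [K = 0]. *)
  have K1 : 0 < K + 1 by lra.
  have d2 : 0 < d / 2 by lra.
  have [m [m0 tailm]] := tail _ (divr_gt0 d2 K1).
  have /cvgrPdist_lt/(_ _ d2) [N' _ eN] := e0.
  exists (N + m + N')%N => // n /= Nn.
  have en : e n <= d / 2.
    have := eN n; rewrite /= sub0r normrN => H.
    apply/ltW/(le_lt_trans (ler_norm _)); apply: H.
    by apply: leq_trans Nn; rewrite leq_addl.
  have mn : (m <= n.+1)%N.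
    by apply: leqW; apply: leq_trans Nn; rewrite -addnA addnCA leq_addr.
  apply: le_trans (xe n) _; rewrite (big_cat_nat m0 mn)/=.
  have head_le : \sum_(1 <= k < m) beta k * x (n - k)%N <= r * M.
    apply: (@le_trans _ _ (\sum_(1 <= k < m) beta k * M)).
      rewrite !big_nat; apply: ler_sum => k /andP[_ km].
      rewrite ler_wpM2l//; apply: xM => /=.
      rewrite leq_subRL; last by apply: leq_trans (ltnW km) _; move: Nn; clear; lia.
      by move: Nn km; clear; lia.
    by rewrite -mulr_suml ler_wpM2r.
  have tail_le : \sum_(m <= k < n.+1) beta k * x (n - k)%N <= d / 2.
    apply: (@le_trans _ _ (\sum_(m <= k < n.+1) beta k * K)).
      by apply: ler_sum => k _; rewrite ler_wpM2l//; have /andP[] := xK (n - k)%N.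
    rewrite -mulr_suml; apply: le_trans (ler_wpM2r K0 (tailm _ mn)) _.
    rewrite -mulrA ler_piMr// ?(ltW d2)// mulrC ler_pdivrMr//; lra.
  lra.
(* [d / (1 - r)] is the fixed point of the map from [M] to [r * M + d], so each improvement only
   shrinks the term in [K]. *)
have iter (d : R) j : 0 < d -> \forall n \near \oo, x n <= r ^+ j * K + d / (1 - r).
  move=> d0; have r1' : 0 < 1 - r by lra.
  have dr : 0 < d / (1 - r) by rewrite divr_gt0.
  elim: j => [|j IH].
    apply: nearW => n; have /andP[_] := xK n; rewrite expr0 mul1r; lra.
  have M0 : 0 <= r ^+ j * K + d / (1 - r).
    by rewrite addr_ge0 ?(ltW dr)// mulr_ge0// exprn_ge0.
  have := step _ _ d0 M0 IH; apply: filterS.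
  have -> : r * (r ^+ j * K + d / (1 - r)) + d = r ^+ j.+1 * K + d / (1 - r).
    by rewrite exprS; field; rewrite gt_eqF.
  by [].
apply/cvgrPdist_lt => eps eps0.
have r1' : 0 < 1 - r by lra.
have half0 : 0 < eps / 2 by lra.
have K1 : 0 < K + 1 by lra.
have rr : `|r| < 1 by rewrite ger0_norm.
have /cvgrPdist_lt/(_ _ (divr_gt0 half0 K1)) [j _ rj] := cvg_expr rr.
have /= := rj j (leqnn j); rewrite sub0r normrN ger0_norm ?exprn_ge0// => rjK.
have rjK2 : r ^+ j * K < eps / 2.
  move: rjK; rewrite ltr_pdivlMr//; apply: le_lt_trans.
  by rewrite ler_wpM2l ?exprn_ge0//; lra.
(* This [d] makes [d / (1 - r)] equal to [eps / 2]; the other half of [eps] bounds [r ^+ j * K]. *)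
have := iter (eps / 2 * (1 - r)) j (mulr_gt0 half0 r1').
apply: filterS => n; rewrite sub0r normrN mulfK ?gt_eqF// => xn.
by have /andP[x0 _] := xK n; rewrite ger0_norm//; lra.
Qed.

Lemma modulus_sum (I : Type) (s : seq I) (F : I -> R[i]) :
  modulus (\sum_(i <- s) F i) <= \sum_(i <- s) modulus (F i).
Proof.
elim/big_rec2 : _ => [|i y z _ le]; first by rewrite ComplexField.Normc.normc0.
by apply: le_trans (le_normcD _ _) _; rewrite lerD2l.
Qed.

(** Every finite set of indices lies in an initial segment, so the ordered partial sums are cofinal
    among the finite ones. *)
Lemma has_sum_series (u : nat -> R[i]) s : has_sum setT u s -> series u @ \oo --> s.
Proof.
move=> us.
have -> : series u = summability.partial_sum (patch (fun=> 0) setT u) \o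
    (fun n => fset_set `I_n).
  apply/funext => n /=; rewrite partial_sumE -fsbig_finite//= -fsbig_ord.
  by rewrite seriesEord; apply: eq_bigr => i _; rewrite patchT// inE.
apply: cvg_comp us => P [A _ AP].
exists (\max_(i <- A) i).+1 => // n /= An; apply: AP => /=.
apply/fsubsetP => i iA; rewrite in_fset_set// inE /=.
by apply: leq_trans An; rewrite ltnS; exact: leq_bigmax_seq.
Qed.

Lemma renewal_cvg (b c : nat -> R[i]) (s : R[i]) (r : R) :
    b 0%N = 1 -> r < 1 -> (forall n, \sum_(1 <= k < n) modulus (b k) <= r) ->
    series b @ \oo --> s ->
    (forall n, \sum_(k < n.+1) b k * c (n - k)%N = 1) ->
  s != 0 /\ c @ \oo --> s^-1.
Proof.
move=> b0 r1 br bs bc.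
have r0 : 0 <= r by have := br 0; rewrite big_geq.
have bsum n : series b n.+1 = 1 + \sum_(1 <= k < n.+1) b k.
  by rewrite seriesEnat /= big_ltn// b0.
have s0 : s != 0.
  (* If [s = 0], some partial sum has modulus below [1 - r]; but it is 1 plus a term of modulus at
     most [r]. *)
  apply: contraTneq isT => s0.
  have /cvg_modulusP/(_ (1 - r)) := bs; rewrite subr_gt0 => /(_ r1) [N _ /(_ N.+1 (leqnSn N))] /=.
  rewrite s0 sub0r normcN bsum => lt.
  have := le_normcD (1 + \sum_(1 <= k < N.+1) b k) (- \sum_(1 <= k < N.+1) b k).
  rewrite addrK normcN (_ : modulus 1 = 1); last by rewrite modulus_real normr1.
  have := le_trans (modulus_sum _ _) (br N.+1).
  by lra.
split; first exact: s0.
(* Since [b 0 = 1], the value [f n] can be isolated in its convolution with [b]. This is used for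
   [c] and for [c - s^-1]. *)
have conv (f : nat -> R[i]) n : f n = \sum_(k < n.+1) b k * f (n - k)%N -
    \sum_(1 <= k < n.+1) b k * f (n - k)%N.
  rewrite -(big_mkord xpredT (fun k => b k * f (n - k)%N)) big_ltn//.
  by rewrite b0 mul1r subn0 addrK.
have conv_le (f : nat -> R[i]) n : modulus (f n) <=
    modulus (\sum_(k < n.+1) b k * f (n - k)%N) +
    \sum_(1 <= k < n.+1) modulus (b k) * modulus (f (n - k)%N).
  rewrite {1}conv; apply: le_trans (le_normcD _ _) _; rewrite normcN lerD2l.
  apply: le_trans (modulus_sum _ _) _; apply: ler_sum => k _.
  by rewrite ComplexField.Normc.normcM.
have r1' : 0 < 1 - r by lra.
(* The bound solves [K = 1 + r * K], which is what the strong induction needs. *)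
have cK n : modulus (c n) <= (1 - r)^-1.
  elim/ltn_ind : n => n IH; apply: le_trans (conv_le c n) _.
  rewrite bc (_ : modulus 1 = 1); last by rewrite modulus_real normr1.
  have -> : (1 - r)^-1 = 1 + r * (1 - r)^-1 by field; rewrite gt_eqF.
  rewrite lerD2l; apply: (@le_trans _ _ (\sum_(1 <= k < n.+1) modulus (b k) * (1 - r)^-1)).
    rewrite !big_nat; apply: ler_sum => k /andP[k1 kn].
    by rewrite ler_wpM2l ?modulus_ge0// IH//; move: k1 kn; clear; lia.
  by rewrite -mulr_suml ler_wpM2r// invr_ge0 ltW.
suff : (fun n => modulus (c n - s^-1)) @ \oo --> (0 : R).
  move=> /cvgrPdist_lt d0; apply/cvg_modulusP => eps eps0.
  apply: filterS (d0 _ eps0) => n; rewrite sub0r normrN ger0_norm ?modulus_ge0//.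
  by rewrite -normcN opprB.
(* The convolution of [b] with [c - s^-1] is 1 minus [s^-1] times a partial sum of [b], which is the
   expression inside the modulus. *)
pose e n := modulus (s^-1 * (s - series b n.+1)).
apply: (@renewal_inequality_cvg0 (fun k => modulus (b k)) _ e r ((1 - r)^-1 + modulus s^-1)) => //.
- by move=> k; exact: modulus_ge0.
- move=> n; rewrite modulus_ge0 /=; apply: le_trans (le_normcD _ _) _.
  by rewrite normcN lerD2r.
- apply/cvgrPdist_lt => eps eps0.
  have s'0 : 0 < modulus s.
    rewrite lt_neqAle modulus_ge0 andbT eq_sym.
    by apply: contra_neq s0 => /ComplexField.Normc.eq0_normc.
  have /cvg_modulusP/(_ (eps * modulus s)) := bs; rewrite mulr_gt0// => /(_ isT) [N _ bN].
  exists N => // n /= Nn; rewrite sub0r normrN ger0_norm ?modulus_ge0// /e.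
  rewrite ComplexField.Normc.normcM ComplexField.Normc.normcV mulrC ltr_pdivrMr//.
  by apply: bN; exact: leqW.
- move=> n; apply: le_trans (conv_le (fun n => c n - s^-1) n) _.
  rewrite lerD2r /e; have -> : \sum_(k < n.+1) b k * (c (n - k)%N - s^-1) =
    s^-1 * (s - series b n.+1); last by [].
  under eq_bigr do rewrite mulrBr.
  rewrite sumrB bc -mulr_suml mulrBr mulVf//.
  by rewrite mulrC seriesEord.
Qed.

End Renewal.

(** * The limit of the coefficients [a_coef] *)

Theorem theorem5 (R : realType) (h : edge -> R[i])
  (h_light : light h) (h_convex : convex h)
  (hb : (\sum_(1 <= n <oo) (modulus (b_coef h n))%:E < 1)%E) :
  [/\ exists_at1 (b_coef h),
      value_at1 (b_coef h) != 0 &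
      a_coef h n @[n --> \oo] --> 1 - 1 / value_at1 (b_coef h)].
Proof.
have b0 n : (0 <= (modulus (b_coef h n))%:E)%E by rewrite lee_fin modulus_ge0.
set r := (\sum_(1 <= n <oo) _)%E in hb.
have r_fin : r \is a fin_num.
  by rewrite ge0_fin_numE ?(lt_trans hb) ?ltry//; exact: nneseries_ge0.
have ex : exists_at1 (b_coef h).
  rewrite /exists_at1 (nneseries_split 0 1)//= big_nat1 add0n.
  by rewrite lte_add_pinfty ?ltry// (lt_trans hb) ?ltry.
(* The unordered sum serves as a limit known to exist, and is then identified with [value_at1]. *)
have bs : series (b_coef h) @ \oo --> set_sum setT (b_coef h).
  apply: has_sum_series; apply: abs_convergent_has_sum.
  by rewrite /abs_convergent -nneseries_esumT.
have -> : value_at1 (b_coef h) = set_sum setT (b_coef h).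
  by apply: cvg_lim bs; exact: norm_hausdorff.
have [|n|s0 cs] := renewal_cvg (b_coef0 h_light) _ _ bs (renewal h_light h_convex) (r := fine r).
- by rewrite -lte_fin fineK.
- rewrite -lee_fin fineK// -sumEFin.
  by apply: nneseries_lim_ge => k _ _; exact: b0.
split; [exact: ex|exact: s0|rewrite div1r].
have -> : a_coef h = (fun n => 1 - c_coef h n).
  by apply/funext => n; exact: a_c_coef.
by apply: cvgB cs; exact: cvg_cst.
Qed.
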